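(* Let $F$ be a finite family of intervals. Consider any run of the reduction procedure: $G_0=F$, and while $G_k$ has a bad interval, $G_{k+1}=G_k\downarrow s_k$ where $s_k$ is an arbitrary minimal bad interval for $G_k$, stopping at the first $G_r$ that has no bad interval. Then the final family $G_r$ is the same for all such runs, and the multiset $\{s_0,\dots,s_{r-1}\}$ of reduced intervals is also the same (up to order) for all such runs.
   Context: For integers $a<b$, $[a,b)=\{x\in\mathbb{Z}: a\le x<b\}$; an interval is a nonempty set of this form. A family is a finite set of intervals. For a set $s$, $F|s=\{f\in F: f\subseteq s\}$. For an integer $x$, $N_x F$ is the number of members of $F$ containing $x$. An interval $s$ is good for $F$ if $N_x(F|s)\le 1$ for some $x\in s$, and bad otherwise; a minimal bad interval is a bad interval containing no other bad interval. Given an interval $s$, let $[a_1,b_1),\dots,[a_k,b_k)$ be the inclusion-maximal members of $F|s$, ordered so that $a_1<\dots<a_k$ (then $b_1<\dots<b_k$). If $a_{j+1}<b_j$ for $1\le j<k$, define $F\downarrow s=(F\setminus\{[a_1,b_1),\dots,[a_k,b_k)\})\cup\{[a_2,b_1),\dots,[a_k,b_{k-1})\}$; this condition holds whenever $s$ is a minimal bad interval for $F$, so $F\downarrow s$ is then defined. *)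

(* Defs.v *)
From HB Require Import structures.
From mathcomp Require Import all_boot all_order all_algebra.
From mathcomp Require Import finmap zify.

Set Implicit Arguments.
Unset Strict Implicit.
Unset Printing Implicit Defensive.

Import Order.TTheory GRing.Theory Num.Theory.
Local Open Scope fset_scope.
Local Open Scope ring_scope.

(* The nonempty interval [a, b) of integers, as the pair of its endpoints;
   nonempty intervals are equal as sets exactly when their endpoints agree. *)
Definition zinterval : Type := {p : int * int | p.1 < p.2}.

HB.instance Definition _ := Choice.on zinterval.

Definition lo (s : zinterval) : int := (val s).1.
Definition hi (s : zinterval) : int := (val s).2.

(* Membership and inclusion below are those of the library's [interval int]. *)
Definition itv_of (s : zinterval) : interval int := `[lo s, hi s[.

Definition subzi (f s : zinterval) : bool := (itv_of f <= itv_of s)%O.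

Definition zfamily : Type := {fset zinterval}.

Definition restrict (F : zfamily) (s : zinterval) : zfamily :=
  [fset f in F | subzi f s].

Definition Ncov (x : int) (F : zfamily) : nat :=
  #|` [fset f in F | x \in itv_of f] |.

Definition good (F : zfamily) (s : zinterval) : Prop :=
  exists2 x : int, x \in itv_of s & (Ncov x (restrict F s) <= 1)%N.

Definition bad (F : zfamily) (s : zinterval) : Prop := ~ good F s.

Definition minimal_bad (F : zfamily) (s : zinterval) : Prop :=
  bad F s /\ forall t : zinterval, subzi t s -> bad F t -> t = s.

Definition maximals (F : zfamily) (s : zinterval) : zfamily :=
  [fset f in restrict F s | all (fun g => subzi f g ==> (g == f)) (restrict F s)].

(* [:: [a_1, b_1); ...; [a_k, b_k)] with a_1 < ... < a_k: distinct maximal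
   members have distinct left endpoints. *)
Definition maxseq (F : zfamily) (s : zinterval) : seq zinterval :=
  sort (fun f g => lo f <= lo g) (enum_fset (maximals F s)).

(* [:: [a_2, b_1); ...; [a_k, b_(k-1))]. The [pmap insub] only puts the pairs
   of endpoints in the type of intervals: under the condition
   a_(j+1) < b_j in [down] below it drops nothing. *)
Definition overlaps (m : seq zinterval) : seq zinterval :=
  pmap (fun p : zinterval * zinterval =>
          (insub (lo p.2, hi p.1) : option zinterval))
       (zip m (behead m)).

(* The partial operation F |-> F ↓ s; [sorted] states a_(j+1) < b_j for
   consecutive members. Lemma [down_defined] below shows that it is defined at
   every minimal bad interval, so no run is cut short by [None]. *)
Definition down (F : zfamily) (s : zinterval) : option zfamily :=
  let m := maxseq F s in
  if sorted (fun f g => lo g < hi f) m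
  then Some ((F `\` maximals F s) `|` [fset f in overlaps m])
  else None.

(* [run F S G]: some complete run from F reduces the intervals listed in S,
   in this order, and stops at G. *)
Inductive run : zfamily -> seq zinterval -> zfamily -> Prop :=
| run_stop F : (forall s, ~ bad F s) -> run F [::] F
| run_step F s F' S G :
    minimal_bad F s -> down F s = Some F' -> run F' S G -> run F (s :: S) G.

Lemma subziE (f s : zinterval) : subzi f s = (lo s <= lo f) && (hi f <= hi s).
Proof. by rewrite /subzi subitvE !bnd_simp. Qed.

Lemma subziP (f s : zinterval) :
  reflect {subset itv_of f <= itv_of s} (subzi f s).
Proof.
apply: (iffP idP) => [|sfs]; first exact: subitvP.
have lf : lo f < hi f := valP f.
have := sfs (lo f); have := sfs (hi f - 1).
rewrite subziE !in_itv /= lexx lf /=.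
lia.
Qed.

Lemma restrictP (F : zfamily) (s f : zinterval) :
  (f \in restrict F s) = (f \in F) && subzi f s.
Proof. by rewrite /restrict !inE. Qed.

Lemma maximalsP (F : zfamily) (s f : zinterval) :
  reflect (f \in restrict F s /\
           forall g, g \in restrict F s -> subzi f g -> g = f)
          (f \in maximals F s).
Proof.
rewrite /maximals !inE /= -restrictP; apply: (iffP andP) => -[fF].
  move/allP => fmax; split=> // g gF fg.
  by apply/eqP; move: (fmax g gF); rewrite fg.
move=> fmax; split=> //; apply/allP => g gF; apply/implyP => fg.
exact/eqP/fmax.
Qed.

Lemma sub_maximal (F : zfamily) (s f : zinterval) :
  f \in restrict F s -> exists2 g, g \in maximals F s & subzi f g.
Proof.
have [n] := ubnP (absz ((lo f - lo s) + (hi s - hi f))).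
elim: n f => // n IHn f lt_n fF.
have [fM|] := boolP (f \in maximals F s).
  by exists f => //; rewrite subziE !lexx.
rewrite /maximals !inE /= -restrictP fF /=.
case/allPn => g gF; rewrite negb_imply => /andP[fg gNf].
have [|h hM gh] := IHn g _ gF; last first.
  by exists h => //; move: fg gh; rewrite !subziE; lia.
have ltfg : (lo g != lo f) || (hi g != hi f).
  rewrite -negb_and; apply: contra gNf => /andP[/eqP lE /eqP hE].
  by apply/eqP/val_inj; rewrite [val g]surjective_pairing
    [val f]surjective_pairing -/(lo g) -/(lo f) -/(hi g) -/(hi f) lE hE.
move: fF gF fg lt_n; rewrite !restrictP !subziE.
lia.
Qed.

Lemma down_defined (F : zfamily) (s : zinterval) :
  minimal_bad F s -> exists G, down F s = Some G.
Proof.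
case=> sbad smin; rewrite /down.
have [_|/negP[]] := boolP (sorted _ _); first by eexists.
have mS : sorted (fun f g => lo f <= lo g) (maxseq F s).
  by apply: sort_sorted => f g; apply: le_total.
have tr : transitive (fun f g : zinterval => lo f <= lo g).
  by move=> y x z; apply: le_trans.
have memE f : (f \in maxseq F s) = (f \in maximals F s) by rewrite mem_sort.
apply/(sortedP s) => i lti.
set m := maxseq F s in mS memE lti *.
set p := nth s m i; set q := nth s m i.+1.
have pM : p \in maximals F s by rewrite -memE mem_nth // ltnW.
have qM : q \in maximals F s by rewrite -memE mem_nth.
rewrite ltNge; apply/negP => pq.
have split_max f : f \in maximals F s -> hi f <= hi p \/ lo q <= lo f.
  move=> fM; have fm : f \in m by rewrite memE.
  have := fm; rewrite -index_mem => ltf.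
  have [le_f|lt_f] := leqP (index f m) i.
    left; rewrite leNgt; apply/negP => hpf.
    have lfp : lo f <= lo p.
      have := sorted_leq_nth tr (fun=> lexx _) s mS.
      by move/(_ (index f m) i ltf (ltnW lti) le_f); rewrite nth_index.
    have [fF _] := maximalsP _ _ _ fM; have [_ /(_ f fF)] := maximalsP _ _ _ pM.
    rewrite subziE lfp ltW // => /(_ isT) fp.
    by rewrite fp ltxx in hpf.
  right; have := sorted_leq_nth tr (fun=> lexx _) s mS.
  by move/(_ i.+1 (index f m) lti ltf lt_f); rewrite nth_index.
have [/[!restrictP]/andP[_ ps] _] := maximalsP _ _ _ pM.
have [/[!restrictP]/andP[_ qs] _] := maximalsP _ _ _ qM.
have lp : lo p < hi p := valP p.
have lq : lo q < hi q := valP q.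
rewrite subziE in ps; rewrite subziE in qs.
have lt_t : lo s < hi p by lia.
pose t : zinterval := exist _ (lo s, hi p) lt_t.
have lt : lo t = lo s by [].
have ht : hi t = hi p by [].
have ts : subzi t s by rewrite subziE lt ht; lia.
have tNs : t <> s.
  by move=> /(congr1 hi); rewrite ht; lia.
apply: tNs; apply: smin => // -[x xt Nx]; apply: sbad.
exists x; first exact: (subziP _ _ ts).
apply: leq_trans Nx; apply: fsubset_leq_card; apply/fsubsetP => f.
rewrite !inE /= => /andP[/andP[fF fs] xf]; rewrite fF xf andbT /=.
have [|h hM fh] := @sub_maximal F s f; first by rewrite restrictP fF.
have := split_max h hM.
have {}xf : x \in itv_of f by [].
move: fs xf xt fh; rewrite !subziE !in_itv /= lt ht => fs xf xt fh.
by case=> ?; lia.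
Qed.

(* Main.v *)
(* If s and t are distinct minimal bad intervals for F, then t is still minimal
   bad for F ↓ s, s is still minimal bad for F ↓ t, and F ↓ s ↓ t = F ↓ t ↓ s.
   This one-step diamond lets any minimal bad interval be moved to the front of
   a complete run, whence the theorem by induction on the run.

   Say s = [a, b), t = [c, d) with a < c and b < d. Minimality makes [c, b)
   good, so some y in it lies in at most one member inside [c, b), while s and t
   cover y twice. Hence s has a maximal member starting before c and containing
   y, t has one ending after b and containing y, and at most one interval is
   maximal for both. Reducing s replaces this common interval, among the maximal
   members of t, by its overlap with its predecessor in s, and changes no other
   maximal member of t. *)
Require Import Defs.
From mathcomp Require Import all_boot all_order all_algebra.
From mathcomp Require Import finmap zify.
From Stdlib Require Import Classical FunctionalExtensionality PropExtensionality.

Set Implicit Arguments.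
Unset Strict Implicit.
Unset Printing Implicit Defensive.

Import Order.TTheory GRing.Theory Num.Theory.
Local Open Scope ring_scope.

(** * Families as relations: maximal members and consecutive pairs *)

Section Predicates.

Implicit Types (P : int -> int -> Prop) (a b c d e l h x y : int).

(* A family is encoded by the relation [P l h] saying that [l, h) belongs to it,
   so that reflecting the line is the substitution [mirror]. *)
Definition within P a b l h := [/\ P l h, a <= l & h <= b].

(** The bound [Ncov <= 1] as uniqueness, since a relation has no cardinality to count. *)
Definition thin P a b x := forall l h l' h',
  within P a b l h -> l <= x < h -> within P a b l' h' -> l' <= x < h' ->
  l = l' /\ h = h'.

Definition goodP P a b := exists2 x, a <= x < b & thin P a b x.

Definition minbad P a b := [/\ a < b, ~ goodP P a b &
  forall c d, a <= c -> c < d -> d <= b -> ~ goodP P c d -> c = a /\ d = b].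

Definition maxl P a b l h := within P a b l h /\
  forall l' h', within P a b l' h' -> l' <= l -> h <= h' -> l' = l /\ h' = h.

Definition consec P a b l h l' h' :=
  [/\ maxl P a b l h, maxl P a b l' h', l < l' &
      forall l'' h'', maxl P a b l'' h'' -> l < l'' -> l'' < l' -> False].

(** A total version of [down]: for an arbitrary [[a, b)] an overlap may be empty; [dn_lt] excludes
    this at a minimal bad interval. *)
Definition dn P a b l h :=
  P l h /\ ~ maxl P a b l h \/ exists l' h', consec P a b l' h l h'.

Lemma bad_two P a b x : ~ goodP P a b -> a <= x < b ->
  exists l h l' h', [/\ within P a b l h /\ l <= x < h,
    within P a b l' h' /\ l' <= x < h' & ~ (l = l' /\ h = h')].
Proof.
move=> nG xab; apply: NNPP => nE; apply: nG; exists x => // l h l' h' w1 c1 w2 c2.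
by apply: NNPP => ne; apply: nE; exists l, h, l', h'.
Qed.

Lemma ex_greatest (Q : int -> Prop) x B : Q x -> (forall y, Q y -> y <= B) ->
  exists2 y, Q y & forall z, Q z -> z <= y.
Proof.
move=> + QB; have [n] := ubnP (absz (B - x)).
elim: n x => // n IHn x lt_n Qx.
have [[z Qz xz]|nE] := classic (exists2 z, Q z & x < z).
  by apply: (IHn z) => //; move: (QB _ Qz) (QB _ Qx); lia.
exists x => // z Qz; rewrite leNgt; apply/negP => xz; apply: nE.
by exists z.
Qed.

(** The slack left around [[l, h)] in [[a, b)] strictly drops at each passage to a larger member. *)
Lemma above_max P a b l h : within P a b l h ->
  exists l' h', [/\ maxl P a b l' h', l' <= l & h <= h'].
Proof.
have [n] := ubnP (absz ((l - a) + (b - h))).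
elim: n l h => // n IHn l h lt_n w.
have [m|nm] := classic (maxl P a b l h); first by exists l, h; split.
have [l' [h' [w' ll hh ne]]] : exists l' h',
    [/\ within P a b l' h', l' <= l, h <= h' & ~ (l' = l /\ h' = h)].
  apply: NNPP => nE; apply: nm; split=> // l' h' w' ll hh.
  by apply: NNPP => ne; apply: nE; exists l', h'.
have [|l2 [h2 [m2 ll2 hh2]]] := IHn l' h' _ w'.
  by case: w w' => _ w1 w2 [_ w1' w2']; lia.
by exists l2, h2; split=> //; lia.
Qed.

(** Maximal members form an antichain under inclusion, so left and right ends are ordered alike. *)
Lemma max_anti P a b l h l' h' : maxl P a b l h -> maxl P a b l' h' ->
  [/\ (l < l') = (h < h'), l = l' -> h = h' & h = h' -> l = l'].
Proof.
move=> [w m] [w' m'].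
have := m _ _ w'; have := m' _ _ w.
case: (ltgtP l l') => ll; case: (ltgtP h h') => hh;
  move=> H1 H2; split; try lia; intuition lia.
Qed.

Lemma consec_hi P a b l h l' h' : consec P a b l h l' h' -> h < h'.
Proof. by case=> m m' ll _; have [<-] := max_anti m m'. Qed.

Lemma consec_inj_succ P a b l1 h1 l2 h2 l h h' :
  consec P a b l1 h1 l h -> consec P a b l2 h2 l h' ->
  [/\ l1 = l2, h1 = h2 & h = h'].
Proof.
case=> m1 m1' ll1 n1 [m2 m2' ll2 n2].
have ll : l1 = l2.
  case: (ltgtP l1 l2) => // H; first by case: (n1 _ _ m2).
  by case: (n2 _ _ m1).
have [_ /(_ ll)? _] := max_anti m1 m2.
by have [_ /(_ erefl)? _] := max_anti m1' m2'.
Qed.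

Lemma consec_inj_pred P a b l l' h l1 h1 l2 h2 :
  consec P a b l h l1 h1 -> consec P a b l' h l2 h2 ->
  [/\ l = l', l1 = l2 & h1 = h2].
Proof.
case=> m1 m1' ll1 n1 [m2 m2' ll2 n2].
have [_ _ /(_ erefl) e] := max_anti m1 m2; subst l'.
have ll : l1 = l2.
  case: (ltgtP l1 l2) => // H; first by case: (n2 _ _ m1').
  by case: (n1 _ _ m2').
by have [_ /(_ ll)? _] := max_anti m1' m2'.
Qed.

Lemma ex_pred P a b l h l' h' : maxl P a b l h -> maxl P a b l' h' -> l < l' ->
  exists l1 h1, [/\ consec P a b l1 h1 l' h', l <= l1 & h <= h1].
Proof.
move=> m m' ll.
have [||l1 [[h1 m1] l1l] H] := @ex_greatest
    (fun z => (exists h1, maxl P a b z h1) /\ z < l') l l'.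
- by split=> //; exists h.
- by move=> y [_]; lia.
have ll1 : l <= l1 by apply: H; split=> //; exists h.
exists l1, h1; split=> //.
  split=> // l2 h2 m2 L2 L2'; have : l2 <= l1 by apply: H; split=> //; exists h2.
  by lia.
by have [? ? ?] := max_anti m1 m; lia.
Qed.

(** * Reflection of the line *)

Definition mirror P l h := P (- h) (- l).

Lemma pred2_ext P Q : (forall l h, P l h <-> Q l h) -> P = Q.
Proof.
move=> PQ; do 2!apply: functional_extensionality => ?.
exact: propositional_extensionality.
Qed.

Lemma mirrorK P : mirror (mirror P) = P.
Proof. by apply: pred2_ext => l h; rewrite /mirror !opprK. Qed.

Lemma mirror_within P a b l h :
  within (mirror P) a b l h <-> within P (- b) (- a) (- h) (- l).
Proof. by rewrite /within /mirror !lerN2; split=> -[]. Qed.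

Lemma mirror_good P a b : goodP (mirror P) a b <-> goodP P (- b) (- a).
Proof.
(* [x] lies in [[l, h)] exactly when [- x - 1] lies in [[- h, - l)]: the shift by one comes from
   half-open intervals. *)
split=> -[x xab T]; exists (- x - 1); try lia.
  move=> l h l' h' w c w' c'; have := T (- h) (- l) (- h') (- l').
  rewrite !mirror_within !opprK => /(_ w _ w'); lia.
move=> l h l' h' /mirror_within w c /mirror_within w' c'.
have := T _ _ _ _ w _ w'; lia.
Qed.

Lemma mirror_minbad P a b : minbad P a b -> minbad (mirror P) (- b) (- a).
Proof.
case=> ab nG M; split; first lia.
  by rewrite mirror_good !opprK.
move=> c d bc cd da; rewrite mirror_good => nG'.
have := M _ _ _ _ _ nG'; lia.
Qed.

Lemma mirror_maxl P a b l h :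
  maxl (mirror P) a b l h <-> maxl P (- b) (- a) (- h) (- l).
Proof.
split=> -[w m]; split; try exact/mirror_within.
  move=> l' h' w' ll hh; have := m (- h') (- l').
  by rewrite mirror_within !opprK => /(_ w'); lia.
by move=> l' h' /mirror_within w' ll hh; have := m _ _ w'; lia.
Qed.

Lemma mirror_consec P a b l h l' h' : consec (mirror P) a b l h l' h' <->
  consec P (- b) (- a) (- h') (- l') (- h) (- l).
Proof.
split=> -[m m' ll N].
  have [ll' _ _] := max_anti m m'.
  split; try exact/mirror_maxl; first lia.
  move=> l2 h2 m2 L1 L2; have m2' : maxl (mirror P) a b (- h2) (- l2).
    by rewrite mirror_maxl !opprK.
  have [? _ _] := max_anti m2' m'; have [? _ _] := max_anti m m2'.
  by apply: (N _ _ m2'); lia.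
have [ll' _ _] := max_anti m m'.
split; try exact/mirror_maxl; first lia.
move=> l2 h2 /mirror_maxl m2 L1 L2.
have [? _ _] := max_anti m2 m'; have [? _ _] := max_anti m m2.
by apply: (N _ _ m2); lia.
Qed.

Lemma mirror_maxlE P a b l h :
  maxl (mirror P) a b l h = maxl P (- b) (- a) (- h) (- l).
Proof. exact/propositional_extensionality/mirror_maxl. Qed.

Lemma mirror_consecE P a b l h l' h' : consec (mirror P) a b l h l' h' =
  consec P (- b) (- a) (- h') (- l') (- h) (- l).
Proof. exact/propositional_extensionality/mirror_consec. Qed.

Lemma mirror_dn P a b : dn (mirror P) (- b) (- a) = mirror (dn P a b).
Proof.
apply: pred2_ext => l h; rewrite /dn {3}/mirror /mirror mirror_maxl !opprK.
split=> -[[? ?]|[l' [h' C]]]; [by left| |by left|]; right; exists (- h'), (- l').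
  by move/mirror_consec: C; rewrite !opprK.
by rewrite mirror_consec !opprK.
Qed.

(** * Reduction at one minimal bad interval *)

Section Reduce.

Variables (P : int -> int -> Prop) (a b : int).
Hypothesis (P_lt : forall l h, P l h -> l < h) (s_min : minbad P a b).

(* [a, e) is good by minimality, while its thin point is covered twice inside
   [a, b). *)
Lemma cut_right e : a < e < b -> exists y, [/\ a <= y < e, thin P a e y &
  exists l h, [/\ maxl P a b l h, l <= y & e < h]].
Proof.
move=> eab; have [ab nG M] := s_min.
have [y yae T] : goodP P a e.
  by apply: NNPP => nG'; have := M a e _ _ _ nG'; lia.
exists y; split=> //.
have [l [h [l' [h' [[w c] [w' c'] ne]]]]] := @bad_two P a b y nG ltac:(lia).
have big l1 h1 : within P a b l1 h1 -> l1 <= y < h1 -> e < h1 ->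
    exists l h, [/\ maxl P a b l h, l <= y & e < h].
  move=> w1 c1 eh; have [l2 [h2 [m2 ? ?]]] := above_max w1.
  by exists l2, h2; split=> //; lia.
have [/(big _ _ w c)//|he] := ltP e h.
have [/(big _ _ w' c')//|he'] := ltP e h'.
case: ne; apply: T => //; first by case: w.
by case: w'.
Qed.

(** Cut at [e = z]: the maximal member found ends after [z], so it comes after [[l, z)] and starts
    at [x] or later, which forces [x <= y]. *)
Lemma overlap_thin l z x h : consec P a b l z x h ->
  exists2 y, x <= y < z & thin P a z y.
Proof.
move=> C; have zh := consec_hi C; case: C => m m' lx N.
have [[Plz al zb] _] := m; have [[Pxh ax hb] _] := m'.
have lz := P_lt Plz.
have [|y [yaz T [l1 [h1 [m1 l1y zh1]]]]] := @cut_right z; first lia.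
exists y => //.
have [? _ _] := max_anti m m1.
by have := N _ _ m1; case: (ltP l1 x); intuition lia.
Qed.

(** Both [[x, z)] and [[l, z)] would lie in [[a, z)] and contain its thin point, although
    [l < x]. *)
Lemma overlap_new l z x h : consec P a b l z x h -> ~ P x z.
Proof.
move=> C Pxz; have [y yxz T] := overlap_thin C.
have [[[Plz al zb] _] [[Pxh ax hb] _] lx _] := C.
have w : within P a z l z by split.
have w' : within P a z x z by split.
by have [||e _] := T _ _ _ _ w _ w'; lia.
Qed.

Lemma dn_lt l h : dn P a b l h -> l < h.
Proof.
by case=> [[/P_lt]//|[l' [h' C]]]; have [y] := overlap_thin C; lia.
Qed.

(* An overlap is sent to the predecessor that created it (to the successor in
   [thin_succ]); this is an injection into the members of the old family. *)
Lemma thin_pred c d c1 d1 y : c1 <= c -> d <= d1 -> thin P c1 d1 y ->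
  (forall l z x h, consec P a b l z x h -> c <= x -> z <= d -> c1 <= l) ->
  thin (dn P a b) c d y.
Proof.
move=> cc dd T H.
have old l h : P l h -> c <= l -> h <= d -> within P c1 d1 l h.
  by split=> //; lia.
have new l z x h : consec P a b l z x h -> c <= x -> z <= d -> x <= y < z ->
    within P c1 d1 l z /\ l <= y < z.
  move=> C cx zd c0; have cl := H _ _ _ _ C cx zd.
  by have [[[? _ _] _] _ ? _] := C; split; [split=> //|]; lia.
move=> l h l' h' [[[p n]|[l1 [h1 C]]] cl hd] c0
  [[[p' n']|[l1' [h1' C']]] cl' hd'] c0'.
- exact: T (old _ _ p _ _) c0 (old _ _ p' _ _) c0'.
- have [w2 c2] := new _ _ _ _ C' cl' hd' c0'.
  have [e1 e2] := T _ _ _ _ (old _ _ p cl hd) c0 w2 c2.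
  by case: C' => m _ _ _; case: n; rewrite e1 e2.
- have [w2 c2] := new _ _ _ _ C cl hd c0.
  have [e1 e2] := T _ _ _ _ (old _ _ p' cl' hd') c0' w2 c2.
  by case: C => m _ _ _; case: n'; rewrite e1 e2.
- have [w1 c1'] := new _ _ _ _ C cl hd c0.
  have [w2 c2] := new _ _ _ _ C' cl' hd' c0'.
  have [e1 e2] := T _ _ _ _ w1 c1' w2 c2; subst h'.
  by have [] := consec_inj_pred C C'.
Qed.

Lemma thin_succ c d y : thin P c d y ->
  (forall l z x h, consec P a b l z x h -> c <= x -> z <= d -> h <= d) ->
  thin (dn P a b) c d y.
Proof.
move=> T H.
have new l z x h : consec P a b l z x h -> c <= x -> z <= d -> x <= y < z ->
    within P c d x h /\ x <= y < h.
  move=> C cx zd c0; have cl := H _ _ _ _ C cx zd; have := consec_hi C.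
  by have [_ [[? _ _] _] ? _] := C; split; [split=> //|]; lia.
move=> l h l' h' [[[p n]|[l1 [h1 C]]] cl hd] c0
  [[[p' n']|[l1' [h1' C']]] cl' hd'] c0'.
- exact: T c0 _ c0'.
- have [w2 c2] := new _ _ _ _ C' cl' hd' c0'.
  have [//|e1 e2] := T l h _ _ _ c0 w2 c2.
  by case: C' => _ m _ _; case: n; rewrite e1 e2.
- have [w2 c2] := new _ _ _ _ C cl hd c0.
  have [//|e1 e2] := T l' h' _ _ _ c0' w2 c2.
  by case: C => _ m _ _; case: n'; rewrite e1 e2.
- have [w1 c1'] := new _ _ _ _ C cl hd c0.
  have [w2 c2] := new _ _ _ _ C' cl' hd' c0'.
  have [e1 e2] := T _ _ _ _ w1 c1' w2 c2; subst l'.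
  by have [] := consec_inj_succ C C'.
Qed.

(** The old thin point survives if all overlaps inside [[c, d)] have their predecessors there, or
    all have their successors there; otherwise a thin point of [[a, d)] takes its place. *)
Lemma dn_good c d : goodP P c d -> goodP (dn P a b) c d.
Proof.
case=> y ycd T.
have [ca|ac] := leP c a.
  exists y => //; apply: thin_pred T _ => // l z x h [[[_ ? _] _] _ _ _] _ _; lia.
have [bd|db] := leP b d.
  exists y => //; apply: thin_succ T _ => l z x h [_ [[_ _ ?] _] _ _] _ _; lia.
have [H|] := classic (forall l z x h,
    consec P a b l z x h -> c <= x -> z <= d -> h <= d).
  by exists y => //; apply: thin_succ T _.
move=> nH.
have [l [z [x [h [C cx zd dh]]]]] : exists l z x h,
    [/\ consec P a b l z x h, c <= x, z <= d & d < h].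
  apply: NNPP => nE; apply: nH => l z x h C cx zd.
  by rewrite leNgt; apply/negP => dh; apply: nE; exists l, z, x, h.
have [|y' [yad T' [l1 [h1 [m1 ly dh1]]]]] := @cut_right d; first lia.
(* The member reaching past [d] comes after [[l, z)], hence starts at [x] or later, so [y'] lies in
   [[c, d)]. *)
have xl1 : x <= l1.
  rewrite leNgt; apply/negP => l1x; case: C => m m' lx N.
  by have [? _ _] := max_anti m m1; apply: (N _ _ m1); lia.
exists y'; first lia.
apply: thin_pred T' _ => //; first lia.
by move=> ? ? ? ? [[[_ ? _] _] _ _ _] _ _.
Qed.

End Reduce.

(** * Two minimal bad intervals, [[a, b)] to the left of [[c, d)] *)

Section TwoBad.

Variables (P : int -> int -> Prop) (a b c d : int).
Hypothesis (P_lt : forall l h, P l h -> l < h).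
Hypothesis (s_min : minbad P a b) (t_min : minbad P c d).
Hypothesis (ac : a < c) (bd : b < d).

Lemma common_thin : c < b -> exists y, [/\ c <= y < b, thin P c b y,
  exists l h, [/\ maxl P a b l h, l < c & y < h] &
  exists l h, [/\ maxl P c d l h, l <= y & b < h]].
Proof.
move=> cb; have [ab nG M] := s_min; have [cd nG' _] := t_min.
have [y ycb T] : goodP P c b.
  by apply: NNPP => nG2; have := M _ _ _ _ _ nG2; lia.
exists y; split=> //.
  have [l [h [l' [h' [[w c0] [w' c0'] ne]]]]] := @bad_two P a b y nG ltac:(lia).
  have [l1 [h1 [w1 L]]] : exists l1 h1, within P a b l1 h1 /\ l1 < c /\ y < h1.
    have [lc|cl] := ltP l c; first by exists l, h; split=> //; lia.
    have [lc'|cl'] := ltP l' c; first by exists l', h'; split=> //; lia.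
    by case: ne; apply: T => //; [case: w|case: w'].
  have [l2 [h2 [m2 ? ?]]] := above_max w1; exists l2, h2; split=> //; lia.
have [l [h [l' [h' [[w c0] [w' c0'] ne]]]]] := @bad_two P c d y nG' ltac:(lia).
have [l1 [h1 [w1 L]]] : exists l1 h1, within P c d l1 h1 /\ l1 <= y /\ b < h1.
  have [lc|cl] := ltP b h; first by exists l, h; split=> //; lia.
  have [lc'|cl'] := ltP b h'; first by exists l', h'; split=> //; lia.
  by case: ne; apply: T => //; [case: w|case: w'].
have [l2 [h2 [m2 ? ?]]] := above_max w1; exists l2, h2; split=> //; lia.
Qed.

(** Two old members through a supposedly thin [x] are followed through the reduction. The cases:
    some maximal member of [[a, b)] starting before [c] reaches past [x]; [x] is outside [[a, b)];
    neither. *)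
Lemma dn_bad : ~ goodP (dn P a b) c d.
Proof.
have [ab nG _] := s_min; have [cd nG' _] := t_min.
case=> x xcd T.
have [[lM [hM [mM lMc xM]]]|noM] := classic (exists l h,
    [/\ maxl P a b l h, l < c & x < h]).
  (* every interval of t removed at [x] is replaced by its overlap with its predecessor,
     which still contains [x] *)
  have img l h : within P c d l h -> l <= x < h ->
      exists h', [/\ within (dn P a b) c d l h', l <= x < h' &
        (P l h /\ h' = h) \/ ~ P l h' /\ maxl P a b l h].
    move=> [p cl hd] c0; have [m|nm] := classic (maxl P a b l h); last first.
      by exists h; split=> //; [split=> //; left|left].
    have [|l1 [h1 [C ll hh]]] := ex_pred mM m; first lia.
    have := consec_hi C => h1h.
    exists h1; split; [split=> //; try lia|lia|].
      by right; exists l1, h.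
    by right; split=> //; apply: overlap_new C.
  have [l [h [l' [h' [[w c0] [w' c0'] ne]]]]] := bad_two nG' xcd.
  have [h1 [w1 c1 K1]] := img _ _ w c0.
  have [h1' [w1' c1' K1']] := img _ _ w' c0'.
  have [e1 e2] := T _ _ _ _ w1 c1 w1' c1'; subst l' h1'.
  apply: ne; split=> //.
  (* Equal images come from equal members: a kept member belongs to [P], an overlap does not, and
     maximal members with the same left end coincide. *)
  case: K1 K1' => [[p e]|[n m]] [[p' e']|[n' m']]; try by subst.
  by have [_ /(_ erefl)] := max_anti m m'.
have [xab|nxab] := boolP (a <= x < b); last first.
  have [l [h [l' [h' [[w c0] [w' c0'] ne]]]]] := bad_two nG' xcd.
  apply: ne; apply: T => //; split; (try by [case: w|case: w']);
    by [left; split; [case: w|case=> -[_ ? ?] _; lia]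
       |left; split; [case: w'|case=> -[_ ? ?] _; lia]].
have low l h : within P a b l h -> l <= x < h -> c <= l.
  move=> w c0; rewrite leNgt; apply/negP => lc; apply: noM.
  by have [l1 [h1 [m1 ? ?]]] := above_max w; exists l1, h1; split=> //; lia.
have [l [h [l' [h' [[w c0] [w' c0'] ne]]]]] := bad_two nG xab.
have cl := low _ _ w c0; have cl' := low _ _ w' c0'.
have [|y [ycb Ty [lM [hM [mM lMc yM]]] [lK [hK [mK lKy bK]]]]] := common_thin.
  lia.
(* So [y < hM <= x < b < hK]: the member [[lK, hK)], which ends beyond [b] and survives, also
   contains [x]. *)
have Mx : hM <= x.
  by rewrite leNgt; apply/negP => xM; apply: noM; exists lM, hM.
have wK : within (dn P a b) c d lK hK.
  case: mK => -[p ? ?] _; split=> //; left; split=> // -[[_ _ ?] _]; lia.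
(* at most one of the two intervals inside [c, b) has no image containing [x] *)
have [l1 [h1 [w1 c1 h1b]]] : exists l1 h1,
    [/\ within (dn P a b) c d l1 h1, l1 <= x < h1 & h1 <= b].
  have [m|nm] := classic (maxl P a b l h); last first.
    by case: w => p ? ?; exists l, h; split=> //; split=> //; [left|lia].
  have [m'|nm'] := classic (maxl P a b l' h'); last first.
    by case: w' => p ? ?; exists l', h'; split=> //; split=> //; [left|lia].
  have [_ Eh _] := max_anti m m'.
  (* If both are maximal, the later one shrinks to its overlap with its predecessor. This
     predecessor ends no earlier than the other member, so the overlap contains [x]. *)
  have [ll|ll|ll] := ltgtP l l'; last by case: ne; split=> //; exact: Eh.
    have [l1 [h1 [C ? ?]]] := ex_pred m m' ll; have := consec_hi C.
    case: w' => p ? ? ?; exists l', h1; split; [split=> //; try lia|lia|lia].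
    by right; exists l1, h'.
  have [l1 [h1 [C ? ?]]] := ex_pred m' m ll; have := consec_hi C.
  case: w => p ? ? ?; exists l, h1; split; [split=> //; try lia|lia|lia].
  by right; exists l1, h.
by have [|? ?] := T _ _ _ _ w1 c1 wK; lia.
Qed.

(** With [y] from [common_thin]: the member starting before [c <= l] ends before [h], and the one
    ending after [b >= h] starts after [l], so [l < y < h]. *)
Lemma shared_thin l h : maxl P a b l h -> maxl P c d l h ->
  exists y, [/\ c <= y < b, thin P c b y, l <= y < h,
    exists l' h', [/\ consec P a b l' h' l h & y < h'] &
    exists l' h', [/\ maxl P c d l' h', l < l', l' <= y & b < h']].
Proof.
move=> m m'; have [[p ? ?] _] := m; have [[_ ? ?] _] := m'; have lh := P_lt p.
have [|y [ycb Ty [lM [hM [mM lMc yM]]] [lK [hK [mK lKy bK]]]]] := common_thin.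
  lia.
have [? _ _] := max_anti mM m; have [? _ _] := max_anti m' mK.
exists y; split=> //; first lia.
  have [|l1 [h1 [C ? ?]]] := ex_pred mM m; first lia.
  by exists l1, h1; split=> //; lia.
by exists lK, hK; split=> //; lia.
Qed.

(** Comparisons go through the point [y] of [shared_thin]: inside [[c, b)] only the shared interval
    passes through it. *)
Lemma maxl_dn l h : maxl (dn P a b) c d l h <->
  maxl P c d l h /\ ~ maxl P a b l h \/
  exists l' h', consec P a b l' h l h' /\ maxl P c d l h'.
Proof.
have old l1 h1 : maxl P c d l1 h1 -> ~ maxl P a b l1 h1 ->
    within (dn P a b) c d l1 h1.
  by move=> [[p ? ?] _] nm; split=> //; left.
split.
- case=> -[[[p n]|[l1 [h1 C]]] cl hd] M; last first.
    have [_ m _ _] := C; have [[q ? ?] _] := m; have hh := consec_hi C.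
    right; exists l1, h1; split=> //.
    (* The successor [[l, h1)] lies in [[c, d)] as well. A maximal member of [[c, d)] around it that
       survives would equal the overlap [[l, h)], which is not in [P]. *)
    have w : within P c d l h1 by split=> //; lia.
    have [l2 [h2 [m2 ll2 hh2]]] := above_max w.
    have [m2'|nm2] := classic (maxl P a b l2 h2).
      have [w2 _] := m2'.
      by have [e1 e2] := m.2 _ _ w2 ll2 hh2; rewrite -e1 -e2.
    have [||e1 e2] := M _ _ (old _ _ m2 nm2); [lia..|].
    by have := @overlap_new _ _ _ P_lt s_min _ _ _ _ C; subst; case: m2 => -[].
  left; split=> //.
  have w : within P c d l h by split.
  have [l2 [h2 [m2 ll2 hh2]]] := above_max w.
  have [m2'|nm2] := classic (maxl P a b l2 h2); last first.
    by have [||<- <-] := M _ _ (old _ _ m2 nm2).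
  have [y [ycb Ty c2 [l1 [h1 [C yh1]]] [lq [hq [mq llq lqy bhq]]]]] :=
    shared_thin m2' m2.
  have h1h2 := consec_hi C.
  have [[p2 ? ?] _] := m2; have [[_ ? ?] _] := m2'.
  (* [[l, h)] sits inside the shared [[l2, h2)]. It lies in the overlap [[l2, h1)], or contains [y]
     and is [[l2, h2)], or starts after [y] and lies in [[lq, hq)]; each is impossible. *)
  have [hh1|h1h] := leP h h1.
    have [|||e1 e2] := M l2 h1; [|lia..|].
      by split; [right; exists l1, h2|lia|lia].
    by have := @overlap_new _ _ _ P_lt s_min _ _ _ _ C; subst.
  have nmq : ~ maxl P a b lq hq by case=> -[_ _ ?] _; lia.
  have yl : y < l.
    rewrite ltNge; apply/negP => ly.
    have [|||e1 e2] := Ty l h l2 h2 _ _ _ c2; [by split=> //; lia|lia|by split=> //; lia|].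
    by apply: n; rewrite e1 e2.
  by have [||? ?] := M _ _ (old _ _ mq nmq); lia.
case=> [[m nm]|[l1 [h1 [C m]]]].
  split; first exact: old.
  move=> l' h' [[[p' n']|[l1 [h1 C]]] cl' hd'] ll hh.
    by apply: m.2.
  have [_ m1 _ _] := C; have [[q ? ?] _] := m1; have := consec_hi C => h'h1.
  have [|||e1 e2] := m.2 l' h1; [by split=> //; lia|lia..|].
  by case: nm; rewrite -e1 -e2.
have [_ m1 _ _] := C; have [[q ? ?] _] := m1; have [[_ ? ?] _] := m.
have hh1 := consec_hi C.
(* [y] lies in the overlap [[l, h)] itself, so a member inside [[c, b)] containing the overlap is
   the shared [[l, h1)]. *)
have [y [ycb Ty c2 [l2 [h2 [C2 yh2]]] [lq [hq [mq llq lqy bhq]]]]] :=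
  shared_thin m1 m.
have [? ? _] := consec_inj_succ C C2; subst l2 h2.
split; first by split; [right; exists l1, h1|lia|lia].
move=> l' h' [[[p' n']|[l3 [h3 C3]]] cl' hd'] ll hh.
  have [h'b|bh'] := leP h' b.
    have [||||e1 e2] := Ty l' h' l h1; [by split|lia|by split=> //; lia|lia|].
    by case: n'; rewrite e1 e2.
  have [|||e1 e2] := m.2 l' h'; [by split|lia|lia|].
  by case: n'; rewrite e1 e2.
have [_ [[q3 ? ?] _] _ _] := C3; have h'h3 := consec_hi C3.
have [||||e1 e2] := Ty l' h3 l h1; [by split|lia|by split=> //; lia|lia|].
by subst; have [] := consec_inj_succ C C3.
Qed.

(** Shrinking the shared interval moves only its right end, and consecutiveness is read off left
    ends. *)
Lemma consec_dn l h l' h' : consec (dn P a b) c d l h l' h' <->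
  exists h1 h1', [/\ consec P c d l h1 l' h1',
    h = h1 /\ ~ maxl P a b l h1 \/ exists l2, consec P a b l2 h l h1 &
    h' = h1' /\ ~ maxl P a b l' h1' \/ exists l2, consec P a b l2 h' l' h1'].
Proof.
have fwd x z : maxl (dn P a b) c d x z -> exists z1, maxl P c d x z1 /\
    (z = z1 /\ ~ maxl P a b x z1 \/ exists l2, consec P a b l2 z x z1).
  move=> /maxl_dn[[m nm]|[l1 [h1 [C m]]]].
    by exists z; split=> //; left.
  by exists h1; split=> //; right; exists l1.
have bwd x z z1 : maxl P c d x z1 ->
    z = z1 /\ ~ maxl P a b x z1 \/ (exists l2, consec P a b l2 z x z1) ->
    maxl (dn P a b) c d x z.
  move=> m [[-> nm]|[l2 C]]; apply/maxl_dn; first by left.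
  by right; exists l2, z1.
split.
  move=> [m m' ll N]; have [h1 [m1 K1]] := fwd _ _ m.
  have [h1' [m1' K1']] := fwd _ _ m'.
  exists h1, h1'; split=> //; split=> // l2 h2 m2 L1 L2.
  have [mA|nA] := classic (maxl P a b l2 h2); last first.
    by apply: (N l2 h2) => //; apply: bwd m2 _; left.
  have [_ [_ _ _ [l3 [h3 [C3 _]]] _]] := shared_thin mA m2.
  by apply: (N l2 h3) => //; apply: bwd m2 _; right; exists l3.
move=> [h1 [h1' [[m m' ll N] K K']]].
split=> //; [exact: bwd K|exact: bwd K'|].
by move=> l2 h2 /fwd[h3 [m3 _]]; apply: N m3.
Qed.

(* The symmetric description of the family obtained by reducing both [a, b)
   and [c, d): an interval maximal for both gives one overlap instead of two. *)
Definition dn2 (P : int -> int -> Prop) (a b c d l h : int) :=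
  [\/ [/\ P l h, ~ maxl P a b l h & ~ maxl P c d l h],
      exists l' h', consec P a b l' h l h' /\ ~ maxl P c d l h',
      exists l' h', consec P c d l' h l h' /\ ~ maxl P a b l' h |
      exists l1 l2 h2 h3, consec P a b l1 h l2 h2 /\ consec P c d l2 h2 l h3].

(** An overlap takes its left end from the successor and its right end from the predecessor.
    Shrinking the successor therefore leaves it as it is, and shrinking the predecessor gives the
    fourth case of [dn2]. *)
Lemma dn_dn2 l h : dn (dn P a b) c d l h <-> dn2 P a b c d l h.
Proof.
have new l1 h1 l2 h2 := @overlap_new _ _ _ P_lt s_min l1 h1 l2 h2.
split.
  case=> [[[[p n]|[l1 [h1 C]]] nM]|[l1 [h1 /consec_dn[h2 [h3 [C K K']]]]]].
  - by constructor 1; split=> // m; apply/nM/maxl_dn; left.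
  - constructor 2; exists l1, h1; split=> // m.
    by apply/nM/maxl_dn; right; exists l1, h1.
  - case: K => [[e nm]|[l2 C2]].
      by subst h2; constructor 3; exists l1, h3.
    by constructor 4; exists l2, l1, h2, h3.
case=> [[p n n']|[l1 [h1 [C n]]]|[l1 [h1 [C n]]]|[l1 [l2 [h2 [h3 [C1 C2]]]]]].
- left; split; first by left.
  by move/maxl_dn => [[]//|[l1 [h1 [/new C _]]]].
- left; split; first by right; exists l1, h1.
  move/maxl_dn => [[[[p _ _] _] _]|[l2 [h2 [C2 m2]]]]; first exact: new C p.
  by have [_ _ e] := consec_inj_succ C C2; subst.
- have [mA|nA] := classic (maxl P a b l h1); last first.
    right; exists l1, h1; apply/consec_dn; exists h, h1; split=> //; by left.
  have [_ m' _ _] := C.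
  have [_ [_ _ _ [l3 [h3 [C3 _]]] _]] := shared_thin mA m'.
  right; exists l1, h3; apply/consec_dn; exists h, h1; split=> //; first by left.
  by right; exists l3.
have [mA|nA] := classic (maxl P a b l h3); last first.
  right; exists l2, h3; apply/consec_dn; exists h2, h3; split=> //; last by left.
  by right; exists l1.
have [_ m' _ _] := C2.
have [_ [_ _ _ [l4 [h4 [C4 _]]] _]] := shared_thin mA m'.
right; exists l2, h4; apply/consec_dn; exists h2, h3; split=> //.
  by right; exists l1.
by right; exists l4.
Qed.

End TwoBad.

(** * Commutation by reflection *)

(** Reflection exchanges the two reduced intervals: the second and third cases trade places and the
    chain of the fourth is read backwards. *)
Lemma mirror_dn2 P a b c d l h :
  dn2 (mirror P) (- d) (- c) (- b) (- a) l h <-> dn2 P a b c d (- h) (- l).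
Proof.
have mE := mirror_maxlE; have cE := mirror_consecE.
rewrite /dn2 {1}/mirror !mE !opprK.
split.
  case=> [[p n n']|[l1 [h1 [C n]]]|[l1 [h1 [C n]]]|[l1 [l2 [h2 [h3 [C C']]]]]].
  - by constructor 1.
  - rewrite cE !opprK in C; rewrite mE !opprK in n.
    by constructor 3; exists (- h1), (- l1).
  - rewrite cE !opprK in C; rewrite mE !opprK in n.
    by constructor 2; exists (- h1), (- l1).
  rewrite cE !opprK in C; rewrite cE !opprK in C'.
  by constructor 4; exists (- h3), (- h2), (- l2), (- l1).
case=> [[p n n']|[l1 [h1 [C n]]]|[l1 [h1 [C n]]]|[l1 [l2 [h2 [h3 [C C']]]]]].
- by constructor 1.
- by constructor 3; exists (- h1), (- l1); rewrite cE mE !opprK.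
- by constructor 2; exists (- h1), (- l1); rewrite cE mE !opprK.
constructor 4; exists (- h3), (- h2), (- l2), (- l1).
by rewrite !cE !opprK.
Qed.

Lemma mirror_lt P : (forall l h, P l h -> l < h) ->
  forall l h, mirror P l h -> l < h.
Proof. by move=> P_lt l h /P_lt; lia. Qed.

Lemma minbad_ltP P a b c d : minbad P a b -> minbad P c d ->
  [\/ (a = c /\ b = d), (a < c /\ b < d) | (c < a /\ d < b)].
Proof.
move=> [ab nG M] [cd nG' M'].
have := M' a b; have := M c d.
case: (ltgtP a c) => ?; case: (ltgtP b d) => ? H H'.
all: try by [constructor 1|constructor 2|constructor 3].
all: try by have [|||? ?] := H _ _ _ nG'; lia.
all: by have [|||? ?] := H' _ _ _ nG; lia.
Qed.

(** Minimality comes from [dn_good]: an interval bad after the reduction was bad before. If [[c, d)]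
    is the left one, badness comes by reflection. *)
Lemma minbad_dn P a b c d : (forall l h, P l h -> l < h) ->
  minbad P a b -> minbad P c d -> ~ (a = c /\ b = d) ->
  minbad (dn P a b) c d.
Proof.
move=> P_lt sm tm ne; have [cd nG M] := tm; split=> //; last first.
  move=> c' d' ? ? ? nG'; apply: M => // G; apply: nG'.
  exact: dn_good.
case: (minbad_ltP sm tm) => // -[? ?]; first exact: dn_bad.
have := @dn_bad (mirror P) (- b) (- a) (- d) (- c) (mirror_lt P_lt)
  (mirror_minbad sm) (mirror_minbad tm).
rewrite mirror_dn mirror_good !opprK; apply; lia.
Qed.

Lemma dnC P a b c d : (forall l h, P l h -> l < h) ->
  minbad P a b -> minbad P c d ->
  dn (dn P a b) c d = dn (dn P c d) a b.
Proof.
move=> P_lt.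
have main a' b' c' d' : minbad P a' b' -> minbad P c' d' -> a' < c' /\ b' < d' ->
    dn (dn P a' b') c' d' = dn (dn P c' d') a' b'.
  move=> sm tm [? ?]; apply: pred2_ext => l h.
  (* [dn_dn2] treats only the order left, then right. Reflection turns the other order into this
     one. *)
  rewrite dn_dn2 // -[P in dn (dn P c' d')]mirrorK.
  rewrite -[c' in dn (dn _ c' _)]opprK -[d' in dn (dn _ _ d')]opprK.
  rewrite mirror_dn -[a' in dn _ a']opprK -[b' in dn _ _ b']opprK mirror_dn.
  rewrite /mirror -/(mirror P) dn_dn2; last first.
  - lia.
  - lia.
  - exact: mirror_minbad.
  - exact: mirror_minbad.
  - exact: mirror_lt.
  by rewrite mirror_dn2 !opprK.
move=> sm tm; case: (minbad_ltP sm tm) => [[-> ->]//|H|H].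
  exact: main.
by rewrite (main c d a b).
Qed.

End Predicates.

(** * Transfer to finite families *)

Local Open Scope fset_scope.

Definition ends (F : zfamily) (l h : int) : Prop :=
  exists2 f, f \in F & lo f = l /\ hi f = h.

Lemma zinterval_eq (f g : zinterval) : lo f = lo g -> hi f = hi g -> f = g.
Proof.
move=> el eh; apply/val_inj.
by rewrite [val f]surjective_pairing [val g]surjective_pairing; congr pair.
Qed.

Lemma zinterval_ends (l h : int) : l < h ->
  exists f : zinterval, lo f = l /\ hi f = h.
Proof. by move=> lh; exists (exist _ (l, h) lh). Qed.

Lemma mem_ends (F : zfamily) (f : zinterval) : ends F (lo f) (hi f) <-> f \in F.
Proof.
split=> [[g gF [el eh]]|fF]; last by exists f.
by rewrite -(zinterval_eq el eh).
Qed.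

Lemma ends_lt (F : zfamily) l h : ends F l h -> l < h.
Proof. by case=> f _ [<- <-]; exact: (valP f). Qed.

Lemma ends_inj : injective ends.
Proof. by move=> F G e; apply/fsetP => f; apply/idP/idP; rewrite -!mem_ends e. Qed.

Lemma within_ends (F : zfamily) a b (s f : zinterval) : lo s = a -> hi s = b ->
  within (ends F) a b (lo f) (hi f) <-> f \in restrict F s.
Proof.
move=> <- <-; rewrite restrictP subziE; split.
  by case=> /mem_ends -> -> ->.
by case/and3P => fF ? ?; split=> //; apply/mem_ends.
Qed.

Lemma cardfs_le1P (T : choiceType) (A : {fset T}) :
  reflect {in A &, forall x y, x = y} (#|` A| <= 1)%N.
Proof.
apply: (iffP idP) => [A1 x y xA yA|A1].
  have : [fset x; y] `<=` A by apply/fsubsetP => z; rewrite !inE => /orP[]/eqP->.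
  move/fsubset_leq_card/leq_trans/(_ A1); rewrite cardfs2.
  by case: eqVneq.
have [->|[x xA]] := fset_0Vmem A; first by rewrite cardfs0.
rewrite -(cardfs1 x); apply: fsubset_leq_card; apply/fsubsetP => y yA.
by rewrite inE (A1 y x).
Qed.

Lemma good_ends (F : zfamily) (s : zinterval) :
  good F s <-> goodP (ends F) (lo s) (hi s).
Proof.
have thinE x : (Ncov x (restrict F s) <= 1)%N <->
    thin (ends F) (lo s) (hi s) x.
  rewrite /Ncov; split.
    move/cardfs_le1P => H l h l' h' w c w' c'.
    have [f fF [el eh]] : ends F l h by case: w.
    have [g gF [el' eh']] : ends F l' h' by case: w'.
    subst; suff -> : f = g by [].
    move/(within_ends _ _ erefl erefl): w => w.
    move/(within_ends _ _ erefl erefl): w' => w'.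
    by apply: H; rewrite !inE /= -restrictP ?w ?w'.
  move=> T; apply/cardfs_le1P => f g.
  rewrite !inE /= -!restrictP => /andP[fF xf] /andP[gF xg].
  by have [||||] := T (lo f) (hi f) (lo g) (hi g);
    [exact/within_ends|by []|exact/within_ends|by []|exact: zinterval_eq].
split=> -[x]; rewrite ?in_itv /= => xs; first by move/thinE; exists x.
by move/thinE; exists x => //; rewrite in_itv.
Qed.

Lemma minimal_bad_ends (F : zfamily) (s : zinterval) :
  minimal_bad F s <-> minbad (ends F) (lo s) (hi s).
Proof.
split.
  case=> sbad M; split; [exact: (valP s)|by rewrite -good_ends|].
  move=> c d sc cd ds nG; have [t [el eh]] := zinterval_ends cd; subst.
  have := M t; rewrite subziE sc ds /bad good_ends.
  by move/(_ isT nG) ->.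
case=> _ nG M; split; first by rewrite /bad good_ends.
move=> t; rewrite subziE /bad good_ends => /andP[st ts] nG'.
have lt : lo t < hi t := valP t.
by have [] := M _ _ st lt ts nG'; exact: zinterval_eq.
Qed.

Lemma maxl_ends (F : zfamily) (s f : zinterval) :
  maxl (ends F) (lo s) (hi s) (lo f) (hi f) <-> f \in maximals F s.
Proof.
split.
  case=> w M; apply/maximalsP; split; first exact/within_ends.
  move=> g gF; rewrite subziE => /andP[fg gf].
  have [] := M (lo g) (hi g) _ fg gf; last exact: zinterval_eq.
  exact/(within_ends _ _ erefl erefl).
case/maximalsP => fF M; split; first exact/within_ends.
move=> l h w ll hh; have [g gF [el eh]] : ends F l h by case: w.
subst; rewrite (M g) ?subziE ?ll //.
exact/(within_ends _ _ erefl erefl).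
Qed.

Lemma maxl_ends_ex (F : zfamily) (s : zinterval) l h :
  maxl (ends F) (lo s) (hi s) l h ->
  exists2 f, f \in maximals F s & lo f = l /\ hi f = h.
Proof.
move=> m; have [[[f fF [el eh]] _ _] _] := m.
by exists f => //; apply/maxl_ends; rewrite el eh.
Qed.

Lemma mem_zip_behead (T : eqType) (x0 : T) (m : seq T) p q :
  reflect (exists i, [/\ (i.+1 < size m)%N, nth x0 m i = p & nth x0 m i.+1 = q])
    ((p, q) \in zip m (behead m)).
Proof.
have sz : size (zip m (behead m)) = (size m).-1.
  by rewrite size_zip size_behead; lia.
apply: (iffP (nthP (x0, x0))) => [[i]|[i [lti ep eq]]].
  rewrite sz => lti; rewrite nth_zip_cond /= sz lti nth_behead => -[ep eq].
  by exists i; split=> //; lia.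
have lti' : (i < (size m).-1)%N by lia.
by exists i; rewrite ?sz // nth_zip_cond /= sz lti' nth_behead ep eq.
Qed.

(** Distinct maximal members have distinct left ends, so [maxseq] increases strictly and no maximal
    member starts between two neighbours. *)
Lemma consec_zip (F : zfamily) (s p q : zinterval) :
  (p, q) \in zip (maxseq F s) (behead (maxseq F s)) <->
  consec (ends F) (lo s) (hi s) (lo p) (hi p) (lo q) (hi q).
Proof.
set m := maxseq F s.
have memE f : (f \in m) = (f \in maximals F s) by rewrite mem_sort.
have tr : transitive (fun f g : zinterval => lo f <= lo g).
  by move=> y x z; apply: le_trans.
have mS : sorted (fun f g => lo f <= lo g) m.
  by apply: sort_sorted => f g; apply: le_total.
have mU : uniq m by rewrite sort_uniq; exact: fset_uniq.
have lo_inj f g : f \in m -> g \in m -> lo f = lo g -> f = g.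
  rewrite !memE -!maxl_ends => mf mg e.
  by have [_ /(_ e)/(zinterval_eq e)] := max_anti mf mg.
have nth_lt i j : (i < size m)%N -> (j < size m)%N ->
    (lo (nth s m i) < lo (nth s m j)) = (i < j)%N.
  move=> li lj; have le_nth := sorted_leq_nth tr (fun=> lexx _) s mS.
  have [ltij|leji] := ltnP i j; last first.
    by apply/negbTE; rewrite -leNgt; exact: le_nth.
  rewrite lt_neqAle (le_nth i j) ?(ltnW ltij) // andbT.
  apply/eqP => /(lo_inj _ _ (mem_nth _ li) (mem_nth _ lj))/eqP.
  by rewrite nth_uniq // ltn_eqF.
split.
  case/(mem_zip_behead s) => i [lti <- <-].
  have li := ltnW lti; split.
  - by apply/maxl_ends; rewrite -memE mem_nth.
  - by apply/maxl_ends; rewrite -memE mem_nth.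
  - by rewrite nth_lt.
  move=> l h /maxl_ends_ex[f]; rewrite -memE => fm [<- _].
  by rewrite -(nth_index s fm) !nth_lt ?index_mem //; lia.
case=> /maxl_ends + /maxl_ends; rewrite -!memE => pm qm pq N.
apply/(mem_zip_behead s); exists (index p m).
have ip : (index p m < size m)%N by rewrite index_mem.
have iq : (index q m < size m)%N by rewrite index_mem.
have lpq : (index p m < index q m)%N by rewrite -nth_lt ?nth_index.
have lt1 : ((index p m).+1 < size m)%N by lia.
split; rewrite ?nth_index //.
have [e|ne] := eqVneq (index p m).+1 (index q m); first by rewrite e nth_index.
have lt2 : ((index p m).+1 < index q m)%N by lia.
have := mem_nth s lt1; rewrite memE -maxl_ends => m1.
case: (N _ _ m1); first by rewrite -{1}(nth_index s pm) nth_lt.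
by rewrite -(nth_index s qm) nth_lt.
Qed.

Lemma ends_down (F G : zfamily) (s : zinterval) : minimal_bad F s ->
  down F s = Some G -> ends G = dn (ends F) (lo s) (hi s).
Proof.
move=> /minimal_bad_ends sm; rewrite /down; case: ifP => // _ [<-].
have ovl f : f \in [fset g in overlaps (maxseq F s)] <-> exists l h,
    consec (ends F) (lo s) (hi s) l (hi f) (lo f) h.
  rewrite inE /= /overlaps mem_pmap; split.
    case/mapP => -[p q] /consec_zip C /= e.
    case: insubP e => // u _ eu [->].
    have [-> ->] : lo u = lo q /\ hi u = hi p by rewrite [lo u]/lo [hi u]/hi eu.
    by exists (lo p), (hi q).
  case=> l [h C]; have [m m' _ _] := C.
  have [p _ [ep ep']] := maxl_ends_ex m; have [q _ [eq eq']] := maxl_ends_ex m'.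
  apply/mapP; exists (p, q).
    by apply/consec_zip; rewrite ep ep' eq eq'.
  by rewrite /= ep' eq -surjective_pairing (valK f).
apply: pred2_ext => l h; split.
  case=> f fG [<- <-]; move: fG; rewrite in_fsetU in_fsetD => /orP[/andP[nm fF]|].
    by left; split; [exact/mem_ends|move/maxl_ends => m; rewrite m in nm].
  by move/ovl; right.
move=> D; have lh := dn_lt (@ends_lt F) sm D.
have [f [el eh]] := zinterval_ends lh; subst; apply/mem_ends; rewrite in_fsetU in_fsetD.
case: D => [[/mem_ends fF]|]; first by move=> nm; rewrite fF andbT; case: (boolP (f \in _)) => // /maxl_ends.
by move/ovl ->; rewrite orbT.
Qed.

(** * Exchange of steps and uniqueness of runs *)

Lemma diamond (F F1 F2 : zfamily) (s t : zinterval) : s <> t ->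
  minimal_bad F s -> minimal_bad F t -> down F s = Some F1 ->
  down F t = Some F2 ->
  [/\ minimal_bad F1 t, minimal_bad F2 s & exists H,
      down F1 t = Some H /\ down F2 s = Some H].
Proof.
move=> st sm tm d1 d2.
have sm' := sm; have tm' := tm; move/minimal_bad_ends in sm'.
move/minimal_bad_ends in tm'.
have e1 := ends_down sm d1; have e2 := ends_down tm d2.
have m1 : minimal_bad F1 t.
  apply/minimal_bad_ends; rewrite e1; apply: minbad_dn => //; first exact: ends_lt.
  by case=> el eh; apply: st; exact: zinterval_eq.
have m2 : minimal_bad F2 s.
  apply/minimal_bad_ends; rewrite e2; apply: minbad_dn => //; first exact: ends_lt.
  by case=> el eh; apply: st; exact: zinterval_eq.
split=> //; have [H1 h1] := down_defined m1; have [H2 h2] := down_defined m2.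
exists H1; rewrite h1 h2; split=> //; congr Some; apply: ends_inj.
rewrite (ends_down m1 h1) (ends_down m2 h2) e1 e2; apply: dnC => //.
exact: ends_lt.
Qed.

Lemma run_exchange (F F1 G : zfamily) (S : seq zinterval) (s : zinterval) :
  run F S G -> minimal_bad F s -> down F s = Some F1 ->
  exists2 S', run F1 S' G & perm_eq S (s :: S').
Proof.
move=> R; elim: R s F1 => {F S G} [F nb|F t F2 S G tm d2 R IH] s F1 sm d1.
  by case: (nb s); case: sm.
have [est|/eqP st] := eqVneq s t.
  by subst t; exists S => //; move: d2; rewrite d1 => -[->].
have [m1 m2 [H [h1 h2]]] := diamond st sm tm d1 d2.
(* From [F2], [s] is moved to the front of the remaining run; what follows starts at [H], so
   prefixing [t] gives a run from [F1]. *)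
have [S' R' pS] := IH _ _ m2 h2.
exists (t :: S'); first exact: run_step m1 h1 R'.
rewrite (perm_trans (y := t :: s :: S')) ?perm_cons //.
by rewrite -[t :: s :: S']/([:: t; s] ++ S') -[s :: t :: S']/([:: s; t] ++ S')
  perm_cat2r (perm_catC [:: t] [:: s]).
Qed.

Theorem mainTheorem7 (F : zfamily) (S1 S2 : seq zinterval) (G1 G2 : zfamily) :
  run F S1 G1 -> run F S2 G2 -> G1 = G2 /\ perm_eq S1 S2.
Proof.
move=> R; elim: R S2 => {F S1 G1} [F nb|F s F1 S G sm d R IH] S2 R2.
  by case: R2 nb => // {}F s F' S G [sbad _] _ _ /(_ s).
have [S' R' pS] := run_exchange R2 sm d.
have [-> pS'] := IH _ R'; split=> //.
by rewrite perm_sym (perm_trans pS) // perm_cons perm_sym.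
Qed.
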